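(* Let $G$ be an infinite finitely generated group with word length $L$. For an almost submultiplicative growth function $\sigma$ with $\beta_G\preccurlyeq\sigma$ the complete growth function $F_L(z)=\sum_{g\in G}\mathsf{e}_g z^{L(g)}$ is a holomorphic function of $z$ on the open unit disc $\{|z|<1\}$ taking values in the strong dual of $\mathcal{A}_\sigma(G)$.
   Context: The word length $L(g)\in\mathbb{N}_0$, with respect to a finite generating set $S=S^{-1}$ of $G$, is the minimal number of elements of $S$ needed to write $g$ as a product, $L(e)=0$. The volume growth is $\beta_G(n)=\#\{g\in G:L(g)\le n\}$. A growth function is a map $\sigma\colon\mathbb{N}_0\to[1,\infty)$ that is monotonically increasing ($\sigma(n)\le\sigma(n+1)$) and unbounded. It is almost submultiplicative if for every $\epsilon>0$ there is $c>0$ with $\sigma(n+m)\le c\,\sigma(n)^{1+\epsilon}\sigma(m)^{1+\epsilon}$ for all $n,m\in\mathbb{N}_0$. For maps $\sigma,\sigma'\colon\mathbb{N}_0\to[1,\infty)$ write $\sigma\preccurlyeq\sigma'$ if there are an integer $c\ge1$ and a real $k\ge1$ with $\sigma(n)\le c\,\sigma'(cn)^k$ for all $n\in\mathbb{N}_0$. $\mathbb{C}[[G]]$ is the space of all formal series $a=\sum_{g\in G}a_g\mathsf{e}_g$, $a_g\in\mathbb{C}$. For $R\ge0$ put $\|a\|_{L,\sigma,R}=\sum_{g}|a_g|\,\sigma(L(g))^R$; $\mathcal{A}_\sigma(G)=\{a\in\mathbb{C}[[G]]:\|a\|_{L,\sigma,R}<\infty\text{ for all }R\ge0\}$ with the locally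 convex topology defined by all these norms. Its strong dual is the topological dual $\mathcal{A}_\sigma(G)'$ with the topology of uniform convergence on bounded sets. As a vector space it is identified with $\bigcup_{R\ge0}\{b\in\mathbb{C}[[G]]:\sup_g|b_g|/\sigma(L(g))^R<\infty\}$, where $b$ corresponds to the functional $a\mapsto\sum_{g\in G}b_g a_{g^{-1}}$; in this way $\mathsf{e}_g$ and $F_L(z)$ are regarded as elements of $\mathcal{A}_\sigma(G)'$. Convention: $z^0=1$. *)

(* Defs.v *)
From HB Require Import structures.
From mathcomp Require Import all_boot all_order all_algebra.
From mathcomp Require Import all_classical all_reals all_analysis.
From mathcomp Require Import finmap complex.
From mathcomp.analysis.showcase Require Import summability.

Set Implicit Arguments.
Unset Strict Implicit.
Unset Printing Implicit Defensive.

Import Order.TTheory GRing.Theory Num.Theory.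
Import numFieldNormedType.Exports.

Local Open Scope classical_set_scope.
Local Open Scope ring_scope.

Section word_length.
Context {G : groupType}.
Implicit Types (S : set G) (g : G) (n : nat).

Definition is_product S n g : Prop :=
  exists w : seq G,
    [/\ size w = n, forall s, s \in w -> S s & (\prod_(s <- w) s = g)%g].

Definition generates S : Prop := forall g, exists n, is_product S n g.

Definition symmetric_set S : Prop := S = [set (s^-1)%g | s in S].

(* The default value 0 is only reached when [g] is not a product of elements of
   [S], which never happens when [S] is symmetric and generates [G]. *)
Definition word_length S g : nat :=
  if pselect (exists n, `[< is_product S n g >]) is left h
  then ex_minn h else 0.

(* [fset_set] is meaningful because balls are finite when [S] is a finite
   generating set. *)
Definition volume_growth (R : realType) S (n : nat) : R :=
  #|` fset_set [set g | (word_length S g <= n)%N] |%:R.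

End word_length.

Section growth.
Context {R : realType}.
Implicit Types f s : nat -> R.

Definition growth_function s : Prop :=
  [/\ forall n, 1 <= s n,
      forall n, s n <= s n.+1
    & forall M, exists n, M < s n].

Definition almost_submultiplicative s : Prop :=
  forall e : R, 0 < e -> exists2 c : R, 0 < c &
    forall n m, s (n + m)%N <= c * s n `^ (1 + e) * s m `^ (1 + e).

Definition growth_le f s : Prop :=
  exists (c : nat) (k : R), [/\ (1 <= c)%N, 1 <= k &
    forall n, f n <= c%:R * s (c * n)%N `^ k].

End growth.

Local Lemma normc_ge0 (R : rcfType) (z : R[i]) : 0 <= Normc.normc z.
Proof. by case: z => a b; exact: sqrtr_ge0. Qed.

(* [Normc.normc z] is the modulus of [z] as an element of [R]; the norm [`|z|]
   is the same number seen in [R[i]]. *)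
Record seminorm (R : realType) (E : lmodType R[i]) := Seminorm {
  seminorm_fun :> E -> R;
  seminormD : forall x y,
    seminorm_fun (x + y) <= seminorm_fun x + seminorm_fun y;
  seminormZ : forall c x,
    seminorm_fun (c *: x) = Normc.normc c * seminorm_fun x
}.

(* [E] with the coarsest vector space topology making all [p i] continuous. *)
Definition seminormed (R : realType) (E : lmodType R[i]) (I : choiceType)
  (p : I -> seminorm E) : Type := E.

Section seminormed.
Local Open Scope convex_scope.
Context (R : realType) (E : lmodType R[i]) (I : choiceType).
Variable p : I -> seminorm E.

Local Notation T := (seminormed p).

HB.instance Definition _ := GRing.Lmodule.on T.

Let pN i (x : E) : p i (- x) = p i x.
Proof. by rewrite -scaleN1r seminormZ normcN Normc.normc1 mul1r. Qed.

Let p0 i : p i 0 = 0.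
Proof. by rewrite -(scale0r (0 : E)) seminormZ Normc.normc0 mul0r. Qed.

Let pB i (x y : E) : p i (x - y) = p i (y - x).
Proof. by rewrite -opprB pN. Qed.

Let p_ge0 i (x : E) : 0 <= p i x.
Proof.
have := seminormD (p i) x (- x); rewrite subrr p0 pN -mulr2n.
by rewrite pmulrn_lge0.
Qed.

Definition semiball (s : seq I) (e : R) (x : T) : set T :=
  [set y | forall i, i \in s -> p i (x - y) < e].

Definition seminorm_entourage : set_system (T * T) :=
  [set A | exists (s : seq I) (e : R),
    0 < e /\ forall x y : T, semiball s e x y -> A (x, y)].

Let ent_filter : Filter seminorm_entourage.
Proof.
split; first by exists [::], 1.
- move=> A B [s [e [e0 sA]]] [t [f [f0 tB]]]; exists (s ++ t), (Num.min e f).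
  split=> [|x y xy]; first by rewrite lt_min e0.
  split; [apply: sA|apply: tB] => i si;
    have := xy i; rewrite mem_cat si ?orbT => /(_ isT);
    by rewrite lt_min => /andP[].
- by move=> A B AB [s [e [e0 sA]]]; exists s, e; split=> // x y /sA /AB.
Qed.

Let ent_diagonal A : seminorm_entourage A -> diagonal `<=` A.
Proof.
move=> [s [e [e0 sA]]] [x y] /diagonalP ->; apply: sA => i _.
by rewrite subrr p0.
Qed.

Let ent_inv A : seminorm_entourage A -> seminorm_entourage A^-1%relation.
Proof.
move=> [s [e [e0 sA]]]; exists s, e; split => // x y xy.
by apply: sA => i si; rewrite pB xy.
Qed.

Let ent_split A : seminorm_entourage A ->
  exists2 B, seminorm_entourage B & (B \; B)%relation `<=` A.
Proof.
move=> [s [e [e0 sA]]].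
exists [set xy | semiball s (e / 2) xy.1 xy.2].
  by exists s, (e / 2); split=> //; rewrite divr_gt0.
move=> [x y] /= [z /= xz zy]; apply: sA => i si.
rewrite (_ : x - y = (x - z) + (z - y)); last by rewrite addrA subrK.
apply: le_lt_trans (seminormD _ _ _) _.
by rewrite [ltRHS]splitr ltrD//; [exact: xz|exact: zy].
Qed.

HB.instance Definition _ :=
  isUniform.Build T ent_filter ent_diagonal ent_inv ent_split.

Lemma nbhs_seminormedP (x : T) (U : set T) :
  nbhs x U <-> exists (s : seq I) (e : R), 0 < e /\ semiball s e x `<=` U.
Proof.
split.
  move=> /nbhsP[A [s [e [e0 sA]]] AU]; exists s, e; split => // y xy.
  by apply: AU; apply/xsectionP; exact: sA.
move=> [s [e [e0 sU]]]; apply/nbhsP.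
exists [set xy | semiball s e xy.1 xy.2].
  by exists s, e.
by move=> y /xsectionP; exact: sU.
Qed.

Let add_cont : continuous (fun x : T * T => x.1 + x.2).
Proof.
move=> [x y] U /nbhs_seminormedP[s [e [e0 sU]]].
exists (semiball s (e / 2) x, semiball s (e / 2) y).
  by split; apply/nbhs_seminormedP; exists s, (e / 2); split=> //;
    rewrite divr_gt0.
move=> [x' y'] /= [xx' yy']; apply: sU => i si.
rewrite /= opprD addrACA; apply: le_lt_trans (seminormD _ _ _) _.
by rewrite [ltRHS]splitr ltrD//; [exact: xx'|exact: yy'].
Qed.

HB.instance Definition _ :=
  PreTopologicalNmodule_isTopologicalNmodule.Build T add_cont.

Let normcE (z : R[i]) : `|z| = (Normc.normc z)%:C%C.
Proof. by case: z. Qed.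

Let normc_near (c : R[i]^o) (d : R) : 0 < d ->
  \forall c' \near c, Normc.normc (c - c') < d.
Proof.
move=> d0; apply/nbhs_ballP; exists d%:C%C; first by rewrite /= ltcR.
by move=> c'; rewrite -ball_normE /= normcE ltcR.
Qed.

Let scale_cont : continuous (fun z : R[i]^o * T => z.1 *: z.2).
Proof.
move=> [c x] U /nbhs_seminormedP[s [e [e0 sU]]].
pose M := 1 + \sum_(i <- s) p i x.
have M1 : 1 <= M by rewrite lerDl sumr_ge0.
have M0 : 0 < M := lt_le_trans ltr01 M1.
have pM i : i \in s -> p i x <= M.
  move=> si; rewrite /M (big_rem i)//= addrCA lerDl addr_ge0//.
  by rewrite sumr_ge0.
pose N := Normc.normc c + 1.
have N0 : 0 < N by rewrite ltr_wpDl// normc_ge0.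
pose d := Num.min 1 (e / 2 / M).
have d0 : 0 < d by rewrite lt_min ltr01 !divr_gt0.
exists ([set c' : R[i]^o | Normc.normc (c - c') < d],
        semiball s (e / 2 / N) x).
  split; first exact: normc_near.
  apply/nbhs_seminormedP; exists s, (e / 2 / N); split=> //.
  by rewrite !divr_gt0.
move=> [c' x'] /= [cc' xx']; apply: sU => i si /=.
rewrite (_ : _ - _ = (c - c') *: x + c' *: (x - x')); last first.
  by rewrite scalerBl scalerBr addrA subrK.
apply: le_lt_trans (seminormD _ _ _) _; rewrite !seminormZ [ltRHS]splitr.
apply: ler_ltD.
  rewrite (@le_trans _ _ (d * M))//.
    by rewrite ler_pM// ?normc_ge0 ?p_ge0 ?pM ?ltW.
  by rewrite -ler_pdivlMr// ge_min lexx orbT.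
have c'N : Normc.normc c' <= N.
  rewrite (_ : c' = c - (c - c')); last by rewrite subKr.
  apply: le_trans (le_normcD _ _) _; rewrite normcN lerD2l ltW//.
  by apply: lt_le_trans cc' _; rewrite ge_min lexx.
apply: (@le_lt_trans _ _ (N * p i (x - x'))); first by rewrite ler_wpM2r.
by rewrite mulrC -ltr_pdivlMr// xx'.
Qed.

HB.instance Definition _ :=
  TopologicalNmodule_isTopologicalLmodule.Build R[i] T scale_cont.

Let semiball_open s e (x : T) : open (semiball s e x).
Proof.
rewrite openE => y xy; apply/nbhs_seminormedP.
pose d := \big[Num.min/1]_(i <- s) (e - p i (x - y)).
exists s, d; split.
  rewrite /d big_seq; elim/big_ind: _ => //= [a b a0 b0|i si].
    by rewrite lt_min a0.
  by rewrite subr_gt0 xy.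
move=> z yz i si.
rewrite (_ : x - z = (x - y) + (y - z)); last by rewrite addrA subrK.
apply: le_lt_trans (seminormD _ _ _) _; rewrite -ltrBrDl.
by apply: lt_le_trans (yz i si) _; rewrite /d; exact: ge_bigmin_seq.
Qed.

Let semiball_convex s e (x : T) : convex_set (semiball s e x).
Proof.
apply/convex_setW => y z; move=> /set_mem xy /set_mem xz l l0 l1.
apply/mem_set => i si.
pose t : R := complex.Re l%:num.
have lE : l%:num = t%:C%C.
  move: l0; rewrite /t; case: (l%:num) => a b /=.
  by rewrite ltcE => /andP[/eqP/= ->].
have t0 : 0 < t by move: l0; rewrite lE ltcR.
have t1 : t < 1 by move: l1; rewrite lE ltcR.
have tN (u : R) : 0 < u -> Normc.normc u%:C%C = u.
  by move=> u0; rewrite /= expr0n addr0 sqrtr_sqr gtr0_norm.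
rewrite (_ : x - _ = l%:num *: (x - y) + (1 - l%:num) *: (x - z)); last first.
  by rewrite !scalerBr addrACA -scalerDl [l%:num + _]addrC subrK scale1r -opprD.
apply: le_lt_trans (seminormD _ _ _) _; rewrite !seminormZ lE.
rewrite -(rmorph1 (real_complex R)) -rmorphB !tN ?subr_gt0//.
have -> : e = t * e + (1 - t) * e by rewrite -mulrDl addrC subrK mul1r.
by rewrite ltrD// ltr_pM2l ?subr_gt0// ?xy ?xz.
Qed.

Let loc_convex :
  exists2 B : set_system T, (forall b, b \in B -> convex_set b) & basis B.
Proof.
exists [set B | exists s e x, B = semiball s e x].
  by move=> B /set_mem -[s [e [x ->]]]; exact: semiball_convex.
split; first by move=> B [s [e [x ->]]]; exact: semiball_open.
move=> x U /nbhs_seminormedP[s [e [e0 sU]]].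
exists (semiball s e x) => //; split; first by exists s, e, x.
by move=> i _; rewrite subrr p0.
Qed.

HB.instance Definition _ := Uniform_isTvs.Build R[i] T loc_convex.

End seminormed.

(* [D] is meant to be open. *)
Definition holomorphic_on (K : numFieldType) (E : preTopologicalLmodType K)
    (D : set K^o) (f : K^o -> E) : Prop :=
  forall z, D z ->
    exists l : E, h^-1 *: (f (h + z) - f z) @[h --> (0 : K^o)^'] --> l.

Section strong_dual.
Context {K : numFieldType} (E : tvsType K).

(* [B] is absorbed by every neighbourhood of 0. When [K] is [R[i]], the scalars
   above a positive [r] are real, by definition of the order on [R[i]]. *)
Definition bounded_subset (B : set E) : Prop :=
  forall U : set E, nbhs 0 U -> exists2 r : K, 0 < r &
    forall t : K, r <= t -> B `<=` [set t *: x | x in U].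

Definition continuous_linear : {pred (E -> K^o)} :=
  [pred f : E -> K^o | `[< linear f /\ continuous f >]].

Record strong_dual : Type := StrongDual {
  functional :> E -> K^o;
  _ : functional \in continuous_linear
}.

HB.instance Definition _ := [isSub for functional].
HB.instance Definition _ := [Choice of strong_dual by <:].

Let continuous_linear_submod : submod_closed continuous_linear.
Proof.
split.
  by apply/asboolP; split=> [a x y|x]; [rewrite scaler0 addr0|exact: cvg_cst].
move=> a f g /asboolP[lf cf] /asboolP[lg cg]; apply/asboolP; split.
  move=> b x y; rewrite !fctE lf lg.
  by rewrite !scalerDr !scalerA [a * b]mulrC addrACA.
move=> x; apply: (@cvgD _ K^o); last exact: cg.
by apply: (@cvgZr _ K^o); exact: cf.
Qed.

HB.instance Definition _ := GRing.isSubmodClosed.Build K (E -> K^o)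
  continuous_linear continuous_linear_submod.
HB.instance Definition _ := [SubChoice_isSubLmodule of strong_dual by <:].

HB.instance Definition _ := Topological.copy strong_dual
  (initial_topology
    (functional : strong_dual -> {family bounded_subset, E -> K^o})).

End strong_dual.

Section rapid_decay.
Context {R : realType} {G : groupType} (L : G -> nat) (sigma : nat -> R).
Implicit Types (a b : G -> R[i]^o) (r : R).

Definition weighted_norm r a : \bar R :=
  (\esum_(g in [set: G]) (Normc.normc (a g) * sigma (L g) `^ r)%:E)%E.

Definition finite_weighted_norms : {pred (G -> R[i]^o)} :=
  [pred a | `[< forall r, 0 <= r -> (weighted_norm r a < +oo)%E >]].

Record rapid_decay : Type := RapidDecay {
  coefficient :> G -> R[i]^o;
  _ : coefficient \in finite_weighted_norms
}.

HB.instance Definition _ := [isSub for coefficient].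
HB.instance Definition _ := [Choice of rapid_decay by <:].

Let term_ge0 r a g : 0 <= Normc.normc (a g) * sigma (L g) `^ r.
Proof. by rewrite mulr_ge0 ?normc_ge0 ?powR_ge0. Qed.

Let wnorm_ge0 r a : (0 <= weighted_norm r a)%E.
Proof. by apply: esum_ge0 => g _; rewrite lee_fin. Qed.

Let wnormD r a b :
  (weighted_norm r (a + b)%R <= weighted_norm r a + weighted_norm r b)%E.
Proof.
rewrite /weighted_norm -esumD; [|by move=> *; rewrite lee_fin..].
apply: le_esum => g _; rewrite -EFinD lee_fin -mulrDl ler_wpM2r ?powR_ge0//.
exact: le_normcD.
Qed.

Let wnormZ_le r (c : R[i]) a :
  (weighted_norm r (c *: a)%R <= (Normc.normc c)%:E * weighted_norm r a)%E.
Proof.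
apply: ub_ereal_sup => _ [X XG <-].
apply: (@le_trans _ _ ((Normc.normc c)%:E *
    \sum_(g \in X) (Normc.normc (a g) * sigma (L g) `^ r)%:E)%E).
  rewrite ge0_mule_fsumr; last by move=> *; rewrite lee_fin.
  apply: lee_fsum => [|g _]; first exact: XG.1.
  by rewrite -EFinM lee_fin mulrA -Normc.normcM.
rewrite lee_wpmul2l ?lee_fin ?normc_ge0//.
by apply: ereal_sup_ubound; exists X.
Qed.

Let finite_weighted_norms_submod : submod_closed finite_weighted_norms.
Proof.
split.
  apply/asboolP => r _; rewrite /weighted_norm esum1 ?ltry// => g _.
  by rewrite Normc.normc0 mul0r.
move=> c a b /asboolP fa /asboolP fb; apply/asboolP => r r0.
apply: le_lt_trans (wnormD _ _ _) _; rewrite lte_add_pinfty ?fb//.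
apply: le_lt_trans (wnormZ_le _ _ _) _.
by rewrite lte_mul_pinfty ?lee_fin ?normc_ge0 ?fa.
Qed.

HB.instance Definition _ := GRing.isSubmodClosed.Build R[i] (G -> R[i]^o)
  finite_weighted_norms finite_weighted_norms_submod.
HB.instance Definition _ := [SubChoice_isSubLmodule of rapid_decay by <:].

Let wnorm_fin (r : {nonneg R}) (a : rapid_decay) :
  weighted_norm r%:num a \is a fin_num.
Proof.
have /asboolP fa := valP a; rewrite ge0_fin_numE ?fa//; exact: wnorm_ge0.
Qed.

Definition norm_fun (r : {nonneg R}) (a : rapid_decay) : R :=
  fine (weighted_norm r%:num a).

Let norm_funD (r : {nonneg R}) (a b : rapid_decay) :
  norm_fun r (a + b) <= norm_fun r a + norm_fun r b.
Proof.
rewrite /norm_fun -fineD// fine_le ?fin_numD ?wnorm_fin//; exact: wnormD.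
Qed.

Let norm_funZ_le (r : {nonneg R}) (c : R[i]) (a : rapid_decay) :
  norm_fun r (c *: a) <= Normc.normc c * norm_fun r a.
Proof.
rewrite -[Normc.normc c]/(fine (Normc.normc c)%:E) -fineM//.
rewrite fine_le ?fin_numM ?wnorm_fin//; exact: wnormZ_le.
Qed.

Let norm_funZ (r : {nonneg R}) (c : R[i]) (a : rapid_decay) :
  norm_fun r (c *: a) = Normc.normc c * norm_fun r a.
Proof.
apply/eqP; rewrite eq_le norm_funZ_le /=.
have [->|c0] := eqVneq c 0.
  by rewrite Normc.normc0 mul0r; apply: fine_ge0; exact: wnorm_ge0.
have nc0 : 0 < Normc.normc c.
  rewrite lt_def normc_ge0 andbT; apply: contra c0 => /eqP nc.
  by rewrite (Normc.eq0_normc nc).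
rewrite mulrC -ler_pdivlMr// mulrC -Normc.normcV.
by rewrite -{1}[a](scalerK c0) norm_funZ_le.
Qed.

Definition norm_family (r : {nonneg R}) : seminorm rapid_decay :=
  Seminorm (norm_funD r) (norm_funZ r).

HB.instance Definition _ := Tvs.copy rapid_decay (seminormed norm_family).

Definition moderate_growth b : Prop :=
  exists2 r : R, 0 <= r &
    exists M : R, forall g, Normc.normc (b g) / sigma (L g) `^ r <= M.

(* The series [\sum_g b_g a_(g^-1)] converges unconditionally, that is, along
   the finite subsets of [G]. *)
Definition represents b (phi : strong_dual rapid_decay) : Prop :=
  moderate_growth b /\
  forall a : rapid_decay,
    partial_sum (fun g => b g * a (g^-1)%g : R[i]^o) @ totally --> phi a.

Definition complete_growth (z : R[i]) : G -> R[i]^o := fun g => z ^+ L g.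

End rapid_decay.

(* Main.v *)
Require Import Defs.
From mathcomp Require Import all_boot all_order all_algebra.
From mathcomp Require Import all_classical all_reals all_analysis.
From mathcomp Require Import complex.
From mathcomp Require Import finmap ring lra.
From mathcomp.analysis.showcase Require Import summability.

Set Implicit Arguments.
Unset Strict Implicit.
Unset Printing Implicit Defensive.

Import Order.TTheory GRing.Theory Num.Theory.
Import numFieldNormedType.Exports.

Local Open Scope classical_set_scope.
Local Open Scope ring_scope.

(** The functional attached to [b] is bounded by [sup_g |b_g|] times the norm
    [||.||_(L,sigma,0)], so estimates uniform in [g] on the coefficients become
    estimates uniform on bounded subsets.  For [|z|, |z + h| <= r < 1] the
    quotient [((z + h)^n - z^n) / h] differs from [n z^(n-1)] by at most
    [|h| / (1 - r)^2] for every [n], so the derivative of [F_L] in the strong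
    dual is [\sum_g L(g) z^(L(g)-1) e_g]. *)

#[local] Existing Instance totally_filter.

(** * Complex norms compared with real moduli *)

Lemma normc_normE (R : rcfType) (z : R[i]) : `|z| = (Normc.normc z)%:C%C.
Proof. by case: z. Qed.

Lemma norm_leC (R : rcfType) (z : R[i]) (M : R) :
  (`|z| <= M%:C%C) = (Normc.normc z <= M).
Proof. by rewrite normc_normE lecR. Qed.

Lemma norm_ltC (R : rcfType) (z : R[i]) (M : R) :
  (`|z| < M%:C%C) = (Normc.normc z < M).
Proof. by rewrite normc_normE ltcR. Qed.

(** The order on [R[i]] compares only numbers with equal imaginary parts, so every positive [e] in a
    limit statement can be replaced by a real [d]. *)
Lemma gt0_realc (R : rcfType) (e : R[i]) : 0 < e ->
  exists2 d : R, 0 < d & e = d%:C%C.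
Proof.
case: e => a b; rewrite ltcE /= => /andP[/eqP -> a0].
by exists a.
Qed.

Lemma continuous_real_complex (R : realType) :
  continuous (fun x : R => x%:C%C : R[i]^o).
Proof.
move=> x; apply/cvgrPdist_lt => e /gt0_realc[d d0 ->]; near=> y.
rewrite -rmorphB norm_ltC /= expr0n addr0 sqrtr_sqr.
by near: y; exact: cvgr_dist_lt.
Unshelve. all: by end_near. Qed.

Lemma partial_sumE (I : choiceType) (V : zmodType) (f : I -> V) (A : {fset I}) :
  partial_sum f A = \sum_(i <- A) f i.
Proof. by rewrite /partial_sum -(big_seq_fsetE _ _ predT). Qed.

(** * Unconditional convergence from bounded sums of moduli *)

Section summation.
Context {R : realType} {I : choiceType}.

(** The limit is the supremum of all finite sums: past a finite set [A] whose sum is within [e] of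
    it, larger sets stay between that sum and the supremum. *)
Lemma cvg_partial_sum_ge0 (f : I -> R) (M : R) : (forall i, 0 <= f i) ->
  (forall A, partial_sum f A <= M) -> cvg (partial_sum f @ totally).
Proof.
move=> f0 fM; pose E := range (partial_sum f).
have E0 : E !=set0 by exists (partial_sum f fset0); exists fset0.
have ubE : ubound E M by move=> _ [A _ <-].
have supE : has_sup E by split => //; exists M.
apply/cvg_ex; exists (sup E); apply/cvgrPdist_lt => e e0.
have [_ [A _ <-] eA] := sup_adherent e0 supE.
exists A => // B AB /=.
have BE : partial_sum f B <= sup E by apply: sup_upper_bound => //; exists B.
rewrite ger0_norm ?subr_ge0// ltrBlDr -ltrBlDl.
apply: lt_le_trans eA _; rewrite !partial_sumE.
(* Since [A] lies in [B], the sum over [B] is the sum over [A] plus nonnegative terms. *)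
have pA : perm_eq [seq i <- B | i \in A] A.
  apply: uniq_perm; rewrite ?filter_uniq ?fset_uniq// => i.
  by rewrite mem_filter; case: (boolP (i \in A)) => //= /(fsubsetP AB).
rewrite -(perm_big _ pA) big_filter [leRHS](bigID (mem A))/=.
by rewrite lerDl sumr_ge0.
Qed.

Lemma cvg_partial_sum_norm (f : I -> R) (M : R) :
  (forall A, partial_sum (fun i => `|f i|) A <= M) ->
  cvg (partial_sum f @ totally).
Proof.
move=> fM.
(* Both [|f| + f] and [|f|] are nonnegative. *)
have -> : partial_sum f =
    partial_sum (fun i => `|f i| + f i) \- partial_sum (fun i => `|f i|).
  apply/funext => A; rewrite /= /partial_sum -sumrB.
  by apply: eq_bigr => i _; rewrite addrAC subrr add0r.
apply: is_cvgB; last exact: cvg_partial_sum_ge0 fM.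
apply: (@cvg_partial_sum_ge0 _ (M + M)) => [i|A].
  by rewrite -lerBlDr sub0r -normrN ler_norm.
apply: (@le_trans _ _ (partial_sum (fun i => `|f i|) A +
                       partial_sum (fun i => `|f i|) A)); last exact: lerD.
by rewrite /partial_sum -big_split ler_sum// => i _; rewrite lerD2l ler_norm.
Qed.

(** Real and imaginary parts are dominated by the modulus, so each sum converges in [R]; the limits
    recombine by continuity. *)
Lemma cvg_partial_sum_normc (f : I -> R[i]^o) (M : R) :
  (forall A, partial_sum (fun i => Normc.normc (f i)) A <= M) ->
  cvg (partial_sum f @ totally).
Proof.
move=> fM.
have cvg_part (p : R[i] -> R) : (forall z, `|p z| <= Normc.normc z) ->
    cvg (partial_sum (fun i => p (f i)) @ totally).
  move=> pz; apply: (@cvg_partial_sum_norm _ M) => A.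
  by apply: le_trans (fM A); apply: ler_sum.
have /cvg_ex[a fa] : cvg (partial_sum (fun i => complex.Re (f i)) @ totally).
  apply: cvg_part => -[x y] /=; rewrite -sqrtr_sqr.
  by rewrite ler_wsqrtr// lerDl sqr_ge0.
have /cvg_ex[b fb] : cvg (partial_sum (fun i => complex.Im (f i)) @ totally).
  apply: cvg_part => -[x y] /=; rewrite -sqrtr_sqr.
  by rewrite ler_wsqrtr// lerDr sqr_ge0.
apply/cvg_ex; exists (a%:C%C + ('i * b%:C)%C).
have -> : partial_sum f = (fun A =>
    (partial_sum (fun i => complex.Re (f i)) A)%:C%C +
    ('i * (partial_sum (fun i => complex.Im (f i)) A)%:C)%C).
  apply/funext => A; rewrite /partial_sum !rmorph_sum mulr_sumr -big_split/=.
  by apply: eq_bigr => i _; exact: complexE.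
apply: (@cvgD _ R[i]^o).
  exact: (cvg_comp _ _ fa (@continuous_real_complex R a)).
apply: (@cvgM R[i]); first exact: cvg_cst.
exact: (cvg_comp _ _ fb (@continuous_real_complex R b)).
Qed.

End summation.

(** * Convergence in the strong dual *)

(** The strong dual carries the initial topology of its inclusion into the maps with uniform
    convergence on bounded sets, so a neighbourhood of [l] contains the preimage of an open set
    there. *)
Lemma cvg_strong_dual (K : numFieldType) (E : tvsType K) (T : Type)
    (F : set_system T) (f : T -> strong_dual E) (l : strong_dual E) :
  Filter F ->
  (forall B, bounded_subset B -> forall e : K, 0 < e ->
    \forall t \near F, forall x, B x -> `|l x - f t x| < e) ->
  f @ F --> l.
Proof.
move=> FF fl V [_ [[W oW <-] Wl] WV]; apply: (filterS WV).
have : (fun t => functional (f t)) @ F -->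
    (functional l : {family @bounded_subset K E, E -> K^o}).
  apply/fam_cvgP => B bB U /uniform_nbhs[A [+ AU]].
  rewrite -entourage_ballE => -[e e0 eA].
  have := fl B bB e e0; apply: filterS => t ft.
  apply: AU => x Bx; apply: eA => /=.
  by rewrite -ball_normE /=; exact: ft.
by apply; exact: open_nbhs_nbhs.
Qed.

(** * Functionals given by bounded coefficients *)

Section pairing.
Context {R : realType} {G : groupType} {L : G -> nat} {sigma : nat -> R}.
Local Notation E := (rapid_decay L sigma).
Local Notation norm0 := (@norm_family R G L sigma 0%:nng).
Implicit Types (a : E) (b : G -> R[i]^o) (M : R).

(** At exponent 0 all weights are 1, and the norm is a supremum of such finite sums. *)
Lemma sum_normc_le a (s : seq G) : uniq s ->
  \sum_(g <- s) Normc.normc (a g) <= norm0 a.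
Proof.
move=> us; rewrite -lee_fin /= /norm_fun fineK; last first.
  rewrite ge0_fin_numE; last first.
    apply: esum_ge0 => g _; rewrite lee_fin.
    by rewrite mulr_ge0 ?powR_ge0// Defs.normc_ge0.
  by have /asboolP fa := valP a; exact: fa.
apply: esum_ge; exists [set` s]; first by split => //; exact: finite_seq.
rewrite -fsbig_seq// sumEFin lee_fin.
by apply: ler_sum => g _; rewrite powRr0 mulr1.
Qed.

(* Only meaningful for bounded [b]; [lim] of a divergent filter is arbitrary. *)
Definition pairing b a : R[i]^o :=
  lim (partial_sum (fun g => b g * a (g^-1)%g : R[i]^o) @ totally).

Lemma sum_normc_pairing_le b M a (A : {fset G}) :
  (forall g, Normc.normc (b g) <= M) ->
  partial_sum (fun g => Normc.normc (b g * a (g^-1)%g)) A <= M * norm0 a.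
Proof.
move=> bM; rewrite partial_sumE.
apply: (@le_trans _ _ (M * \sum_(g <- A) Normc.normc (a (g^-1)%g))).
  rewrite mulr_sumr ler_sum// => g _.
  by rewrite Normc.normcM ler_wpM2r// Defs.normc_ge0.
apply: ler_wpM2l; first by apply: le_trans (bM 1%g); exact: Defs.normc_ge0.
(* Inversion is injective, so reindexing by it keeps the list duplicate-free. *)
rewrite -(big_map (fun g => (g^-1)%g) predT (fun g => Normc.normc (a g))).
by apply: sum_normc_le; rewrite (map_inj_uniq (@invg_inj G)) fset_uniq.
Qed.

Lemma cvg_pairing b M a : (forall g, Normc.normc (b g) <= M) ->
  partial_sum (fun g => b g * a (g^-1)%g : R[i]^o) @ totally --> pairing b a.
Proof.
move=> bM; apply: (@cvg_partial_sum_normc _ _ _ (M * norm0 a)) => A.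
exact: sum_normc_pairing_le.
Qed.

(** Every finite partial sum obeys the bound, and some partial sum is within any [e > 0] of the
    limit. *)
Lemma normc_pairing_le b M a : (forall g, Normc.normc (b g) <= M) ->
  Normc.normc (pairing b a) <= M * norm0 a.
Proof.
move=> bM; apply/ler_addgt0Pr => e e0.
have e0' : 0 < e%:C%C :> R[i] by rewrite ltcR.
have /cvgrPdist_lt/(_ _ e0') := @cvg_pairing b M a bM.
move=> /filter_ex[A]; rewrite norm_ltC => pA.
rewrite -[pairing b a](subrK (partial_sum (fun g => b g * a (g^-1)%g) A)).
apply: le_trans (le_normcD _ _) _; rewrite addrC lerD ?(ltW pA)//.
apply: le_trans (sum_normc_pairing_le a A bM).
rewrite -norm_leC /partial_sum; apply: le_trans (ler_norm_sum _ _ _) _.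
by rewrite rmorph_sum ler_sum// => g _; rewrite normc_normE.
Qed.

Lemma lim_pairing b a (l : R[i]^o) :
  partial_sum (fun g => b g * a (g^-1)%g : R[i]^o) @ totally --> l ->
  pairing b a = l.
Proof. by move=> /cvg_lim; apply; exact: norm_hausdorff. Qed.

(** The bounds [M] and [M'] make both series converge, so that the limits may be added. *)
Lemma pairing_linear_l b b' M M' (c : R[i]) a :
  (forall g, Normc.normc (b g) <= M) -> (forall g, Normc.normc (b' g) <= M') ->
  pairing (c *: b + b') a = c *: pairing b a + pairing b' a.
Proof.
move=> bM b'M'; apply: lim_pairing.
have -> : partial_sum (fun g => (c *: b + b') g * a (g^-1)%g : R[i]^o) =
    c \*: partial_sum (fun g => b g * a (g^-1)%g : R[i]^o) \+
    partial_sum (fun g => b' g * a (g^-1)%g : R[i]^o).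
  apply/funext => A; rewrite /= /partial_sum scaler_sumr -big_split/=.
  by apply: eq_bigr => g _; rewrite mulrDl scalerAl.
apply: cvgD; last exact: cvg_pairing b'M'.
by apply: cvgZl_tmp; exact: cvg_pairing bM.
Qed.

Lemma pairing_linear_r b M : (forall g, Normc.normc (b g) <= M) ->
  linear (pairing b).
Proof.
move=> bM c a a'; apply: lim_pairing.
have -> : partial_sum (fun g => b g * (c *: a + a') (g^-1)%g : R[i]^o) =
    c \*: partial_sum (fun g => b g * a (g^-1)%g : R[i]^o) \+
    partial_sum (fun g => b g * a' (g^-1)%g : R[i]^o).
  apply/funext => A; rewrite /= /partial_sum scaler_sumr -big_split/=.
  by apply: eq_bigr => g _; rewrite [LHS]mulrDr; congr (_ + _); exact: mulrCA.
apply: cvgD; last exact: cvg_pairing bM.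
by apply: cvgZl_tmp; exact: cvg_pairing bM.
Qed.

Lemma nbhs_norm0 (x : E) (e : R) : 0 < e ->
  nbhs x [set y | norm0 (x - y) < e].
Proof.
move=> e0; apply/(@nbhs_seminormedP _ _ _ (@norm_family R G L sigma)).
exists [:: 0%:nng], e; split => // y; apply; exact: mem_head.
Qed.

(** Some multiple [C] of the open unit ball of [norm0] absorbs [B]; homogeneity turns this into a
    bound by [C]. *)
Lemma bounded_subset_norm0 (B : set E) : bounded_subset B ->
  exists2 C : R, 0 < C & forall a, B a -> norm0 a <= C.
Proof.
move=> /(_ _ (nbhs_norm0 0 ltr01))[r /gt0_realc[C C0 ->] BC].
exists C => // a Ba.
have [x /ltW + <-] := BC _ (lexx _) _ Ba.
rewrite sub0r -[- x]scaleN1r seminormZ normcN Normc.normc1 mul1r => x1.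
rewrite seminormZ (_ : Normc.normc _ = C) ?ler_piMr ?(ltW C0)//.
by rewrite /= expr0n addr0 sqrtr_sqr gtr0_norm.
Qed.

Lemma pairing_continuous_linear b M : (forall g, Normc.normc (b g) <= M) ->
  (pairing b : E -> R[i]^o) \in @continuous_linear R[i] E.
Proof.
move=> bM; apply/asboolP; split; first exact: pairing_linear_r bM.
have M0 : 0 <= M by apply: le_trans (bM 1%g); exact: Defs.normc_ge0.
move=> x; apply/(@cvgrPdist_lt _ _ _ _ (nbhs_filter x)) => e.
move=> /gt0_realc[d d0 ->].
(* Dividing by [M + 1] rather than [M] covers the case [M = 0]. *)
have dM : 0 < d / (M + 1) by rewrite divr_gt0// ltr_wpDl.
near=> y; have xy : norm0 (x - y) < d / (M + 1).
  by near: y; exact: nbhs_norm0.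
have -> : pairing b x - pairing b y = pairing b (x - y).
  have lin := pairing_linear_r bM (-1) y x.
  by rewrite [x - y]addrC -[- y]scaleN1r lin scaleN1r addrC.
rewrite norm_ltC (le_lt_trans (normc_pairing_le _ bM))//.
move: xy; rewrite ltr_pdivlMr ?ltr_wpDl// => /(le_lt_trans _); apply.
rewrite mulrC ler_wpM2l ?lerDl//.
(* The empty sum shows that [norm0] is nonnegative. *)
by have := sum_normc_le (x - y) (isT : uniq [::]); rewrite big_nil.
Unshelve. all: by end_near. Qed.

(* Equal to 0 when [pairing b] is not a continuous linear form. *)
Definition dual_pairing b : strong_dual E := insubd 0 (pairing b).

Lemma dual_pairingE b M : (forall g, Normc.normc (b g) <= M) ->
  functional (dual_pairing b) = pairing b.
Proof. by move=> /pairing_continuous_linear bE; exact: (insubdK _ bE). Qed.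

End pairing.

(** * Estimates for powers, uniform in the exponent *)

Section monomial.
Context {K : numFieldType}.
Implicit Types (z h r : K).

(** Induction on [n]: the bound is the fixed point of [x |-> r * x + 1], which matches the product
    rule for [z * z ^+ n]. *)
Lemma norm_deriv_expr_le z r n : `|z| <= r -> r < 1 ->
  `|n%:R * z ^+ n.-1| <= (1 - r)^-1.
Proof.
move=> zr r1; have r0 : 0 <= r := le_trans (normr_ge0 _) zr.
have c0 : 0 < 1 - r by rewrite subr_gt0.
elim: n => [|n IH]; first by rewrite mul0r normr0 invr_ge0 ltW.
have -> : n.+1%:R * z ^+ n = z * (n%:R * z ^+ n.-1) + z ^+ n.
  (* At [n = 0] the truncated predecessor makes [z * z ^+ n.-1 = z ^+ n] fail in general, but the
     factor [0%:R] removes that term. *)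
  case: n {IH} => [|n]; first by rewrite mul0r mulr0 add0r mul1r.
  by rewrite mulrCA -exprS -[in LHS]addn1 natrD mulrDl mul1r.
apply: le_trans (ler_normD _ _) _; rewrite normrM normrX.
apply: (@le_trans _ _ (r * (1 - r)^-1 + 1)).
  by apply: lerD; [exact: ler_pM|rewrite exprn_ile1// (le_trans zr)// ltW].
rewrite -[X in _ + X](divff (lt0r_neq0 c0)) -mulrDl addrC subrK.
by rewrite mul1r.
Qed.

(** The remainder for [n.+1] is [h + z] times that for [n], plus [n%:R * z ^+ n.-1 * h ^+ 2]. The
    bound is the fixed point of [x |-> r * x + |h|^2 / (1 - r)]. *)
Lemma norm_taylor_expr_le z h r n : `|z| <= r -> `|h + z| <= r -> r < 1 ->
  `|(h + z) ^+ n - z ^+ n - n%:R * z ^+ n.-1 * h| <= `|h| ^+ 2 / (1 - r) ^+ 2.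
Proof.
move=> zr hzr r1; have r0 : 0 <= r := le_trans (normr_ge0 _) zr.
have c0 : 0 < 1 - r by rewrite subr_gt0.
elim: n => [|n IH].
  rewrite !expr0 subrr !mul0r subrr normr0.
  by rewrite mulr_ge0 ?exprn_ge0 ?invr_ge0 ?exprn_ge0// ltW.
have -> : (h + z) ^+ n.+1 - z ^+ n.+1 - n.+1%:R * z ^+ n * h =
    (h + z) * ((h + z) ^+ n - z ^+ n - n%:R * z ^+ n.-1 * h) +
    n%:R * z ^+ n.-1 * h ^+ 2.
  case: n {IH} => [|n] /=; first by ring.
  by rewrite !exprS; ring.
apply: le_trans (ler_normD _ _) _; rewrite normrM [in leLHS]normrM normrX.
apply: (@le_trans _ _ (r * (`|h| ^+ 2 / (1 - r) ^+ 2) +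
                       (1 - r)^-1 * `|h| ^+ 2)).
  apply: lerD; first exact: ler_pM.
  by rewrite ler_wpM2r ?exprn_ge0// norm_deriv_expr_le.
rewrite le_eqVlt; apply/orP; left; apply/eqP.
by field; rewrite lt0r_neq0.
Qed.

Lemma norm_diff_quotient_expr_le z h r n :
  h != 0 -> `|z| <= r -> `|h + z| <= r -> r < 1 ->
  `|n%:R * z ^+ n.-1 - h^-1 * ((h + z) ^+ n - z ^+ n)| <= `|h| / (1 - r) ^+ 2.
Proof.
move=> h0 zr hzr r1; have nh0 : 0 < `|h| by rewrite normr_gt0.
rewrite -(ler_pM2l nh0) -normrM mulrA -expr2.
rewrite mulrBr mulVKf// -normrN opprB [h * _]mulrC.
exact: norm_taylor_expr_le.
Qed.

End monomial.

(** * Differentiating the complete growth function *)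

Section complete_growth.
Context {R : realType} {G : groupType} (L : G -> nat) (sigma : nat -> R).
Local Notation E := (rapid_decay L sigma).

Lemma normc_complete_growth_le1 (z : R[i]) (g : G) : `|z| < 1 ->
  Normc.normc (complete_growth L z g) <= 1.
Proof. by move=> z1; rewrite -norm_leC normrX exprn_ile1// ltW. Qed.

Lemma normc_linear_comb_le (b b' : G -> R[i]^o) (M M' : R) (c : R[i]) :
  (forall g, Normc.normc (b g) <= M) -> (forall g, Normc.normc (b' g) <= M') ->
  forall g, Normc.normc ((c *: b + b') g) <= Normc.normc c * M + M'.
Proof.
move=> bM b'M' g; apply: le_trans (le_normcD _ _) _.
by rewrite lerD// Normc.normcM ler_wpM2l// Defs.normc_ge0.
Qed.

Lemma holomorphic_dual_pairing :
  holomorphic_on [set z : R[i]^o | `|z| < 1]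
    (fun z => dual_pairing (complete_growth L z) : strong_dual E).
Proof.
move=> z /= z1.
pose b' : G -> R[i]^o := fun g => (L g)%:R * z ^+ (L g).-1.
(* The midpoint of [|z|] and 1 leaves room for [h + z] to stay in the disc of radius [r < 1]. *)
pose r := (Normc.normc z + 1) / 2.
have nz1 : Normc.normc z < 1 by rewrite -norm_ltC.
have [zr r1] : Normc.normc z < r /\ r < 1 by split; rewrite /r; lra.
have rC1 : r%:C%C < 1 :> R[i] by rewrite ltcR.
have zrC : `|z| <= r%:C%C by rewrite norm_leC ltW.
have r10 : 0 < 1 - r by rewrite subr_gt0.
have b'M g : Normc.normc (b' g) <= (1 - r)^-1.
  rewrite -norm_leC fmorphV rmorphB rmorph1.
  exact: norm_deriv_expr_le.
exists (dual_pairing b'); apply: cvg_strong_dual => B bB e /gt0_realc[d d0 ->].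
have [C C0 BC] := bounded_subset_norm0 bB.
(* Chosen so that [|h| < k] gives [|h| / (1 - r) ^+ 2 * C < d], with [C] bounding [norm0] on [B]. *)
pose k := d * (1 - r) ^+ 2 / C.
have k0 : 0 < k by rewrite divr_gt0 ?mulr_gt0 ?exprn_gt0.
have k0C : 0 < k%:C%C :> R[i] by rewrite ltcR.
have zr0C : 0 < (r - Normc.normc z)%:C%C :> R[i] by rewrite ltcR subr_gt0.
near=> h; have h0 : h != 0 by near: h; exact: nbhs_dnbhs_neq.
have hk : Normc.normc h < k.
  by rewrite -norm_ltC; near: h; exact: dnbhs0_lt.
have hzr : Normc.normc (h + z) <= r.
  apply: le_trans (le_normcD _ _) _; rewrite -lerBrDr ltW// -norm_ltC.
  by near: h; exact: dnbhs0_lt.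
have hz1 : `|h + z| < 1 by rewrite norm_ltC (le_lt_trans hzr).
have bz g := normc_complete_growth_le1 g z1.
have bhz g := normc_complete_growth_le1 g hz1.
(* The difference has the shape [c *: b + b'], so two uses of [pairing_linear_l] turn the error
   functional into a single pairing. *)
pose q := -1 *: complete_growth L z + complete_growth L (h + z).
have bq := normc_linear_comb_le (-1) bz bhz.
have bD g : Normc.normc ((- h^-1 *: q + b') g) <= Normc.normc h / (1 - r) ^+ 2.
  rewrite -norm_leC rmorphM /= -normc_normE fmorphV rmorphXn rmorphB rmorph1.
  have -> : (- h^-1 *: q + b') g =
      (L g)%:R * z ^+ (L g).-1 - h^-1 * ((h + z) ^+ L g - z ^+ L g).
    rewrite addrC /q scaleN1r [- _ + _]addrC; congr (_ + _).
    exact: mulNr.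
  by apply: norm_diff_quotient_expr_le => //; rewrite norm_leC.
move=> a /BC aC.
have -> : dual_pairing b' a -
    (h^-1 *: (dual_pairing (complete_growth L (h + z)) -
              dual_pairing (complete_growth L z) : strong_dual E)) a =
    pairing (- h^-1 *: q + b') a.
  rewrite (pairing_linear_l _ _ bq b'M) (pairing_linear_l _ _ bz bhz).
  rewrite -(dual_pairingE b'M) -(dual_pairingE bz) -(dual_pairingE bhz).
  by rewrite scaleN1r scaleNr [RHS]addrC [in RHS](addrC (- _)).
rewrite norm_ltC; apply: le_lt_trans (normc_pairing_le _ bD) _.
apply: (@le_lt_trans _ _ (Normc.normc h / (1 - r) ^+ 2 * C)).
  by rewrite ler_wpM2l// divr_ge0 ?Defs.normc_ge0 ?exprn_ge0 ?ltW.
by rewrite mulrAC ltr_pdivrMr ?exprn_gt0// -ltr_pdivlMr.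
Unshelve. all: by end_near. Qed.

End complete_growth.

Unset Implicit Arguments.
Set Strict Implicit.
Set Printing Implicit Defensive.

Theorem corollary9p2 (R : realType) (G : groupType) (S : set G)
    (sigma : nat -> R) :
  infinite_set [set: G] ->
  finite_set S -> symmetric_set S -> generates S ->
  growth_function sigma ->
  almost_submultiplicative sigma ->
  growth_le (volume_growth R S) sigma ->
  exists F : R[i]^o -> strong_dual (rapid_decay (word_length S) sigma),
    (forall z : R[i], `|z| < 1 ->
       represents (complete_growth (word_length S) z) (F z)) /\
    holomorphic_on [set z : R[i]^o | `|z| < 1] F.
Proof.
move=> _ _ _ _ _ _ _; set L := word_length S.
(* On the disc the coefficients have modulus at most 1, so [dual_pairing] is the actual pairing
   there; elsewhere it may take its default value 0. *)
exists (fun z => dual_pairing (complete_growth L z)); split.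
  move=> z z1; have b1 g := normc_complete_growth_le1 L g z1.
  split; first by exists 0 => //; exists 1 => g; rewrite powRr0 divr1.
  by move=> a; rewrite (dual_pairingE b1); exact: cvg_pairing b1.
exact: holomorphic_dual_pairing.
Qed.
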